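(* Let $\mathcal{P}$ be a finite set of primes. Then for some integer $r$ with $0\le r\le \#\mathcal{P}$ we have $\gamma(\mathcal{P})\ge \gamma_r$. Consequently, $\Gamma=\inf_{r\ge 0}\gamma_r$.
   Context: For a finite set $\mathcal{P}$ of primes (possibly empty), let $1_{\mathcal{P}}(n)=1$ if $\gcd\big(n,\prod_{p\in\mathcal{P}}p\big)=1$ and $1_{\mathcal{P}}(n)=0$ otherwise, and let $\delta_{\mathcal{P}}=\lim_{x\to\infty}\frac1x\sum_{n\le x}1_{\mathcal{P}}(n)=\prod_{p\in\mathcal{P}}(1-1/p)$. The generalized Euler constant of $\mathcal{P}$ is $$\gamma(\mathcal{P})=\lim_{x\to\infty}\Big\{\sum_{n\le x}\frac{1_{\mathcal{P}}(n)}{n}-\delta_{\mathcal{P}}\log x\Big\}$$ (the limit exists). For $r\ge1$, $\gamma_r=\gamma(\{p_1,\dots,p_r\})$, where $p_1<p_2<\cdots$ are the primes in increasing order, and $\gamma_0=\gamma(\emptyset)=\gamma$ is Euler's constant. Finally $\Gamma=\inf\{\gamma(\mathcal{P}):\mathcal{P}\text{ a finite set of primes}\}$. *)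

(* Defs.v *)
From mathcomp Require Import all_boot all_order all_algebra.
From mathcomp Require Import finmap.
From mathcomp Require Import all_classical all_reals all_analysis.

Set Implicit Arguments.
Unset Strict Implicit.
Unset Printing Implicit Defensive.

Import Order.TTheory GRing.Theory Num.Theory.
Import numFieldNormedType.Exports.

Local Open Scope classical_set_scope.
Local Open Scope ring_scope.

Definition prime_fset (P : {fset nat}) : Prop := forall p, p \in P -> prime p.

(* The limits below run over real x; for x >= 0 the index n ranges over
   1 <= n <= floor x. *)
Section EulerConstant.
Variable R : realType.
Implicit Types (P : {fset nat}) (x : R).

Definition sifted P (n : nat) : R := (gcdn n (\prod_(p <- P) p)%N == 1%N)%:R.

Definition density P : R :=
  lim ((fun x => x^-1 * \sum_(1 <= n < (Num.truncn x).+1) sifted P n) @ +oo).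

Definition gen_euler P : R :=
  lim ((fun x => \sum_(1 <= n < (Num.truncn x).+1) sifted P n / n%:R
                 - density P * ln x) @ +oo).

End EulerConstant.

Lemma next_prime_subproof (m : nat) : exists p, (m < p)%N && prime p.
Proof. by have [p mp pp] := prime_above m; exists p; rewrite mp. Qed.

Definition next_prime (m : nat) : nat := ex_minn (next_prime_subproof m).

(* 0-based: nth_prime 0 = 2 *)
Definition nth_prime (i : nat) : nat := iter i next_prime 2%N.

Definition first_primes (r : nat) : {fset nat} :=
  [fset p in mkseq nth_prime r]%fset.

Definition euler_r (R : realType) (r : nat) : R := gen_euler R (first_primes r).

(* The infimum is taken in the extended reals, so that no convention for sets
   without a lower bound intervenes. *)
Definition Gamma (R : realType) : \bar R :=
  ereal_inf [set (gen_euler R P)%:E | P in [set P | prime_fset P]].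

(* Main.v *)
Require Import Defs.
From mathcomp Require Import all_boot all_order all_algebra.
From mathcomp Require Import finmap.
From mathcomp Require Import all_classical all_reals all_analysis.
From mathcomp Require Import ring.

Set Implicit Arguments.
Unset Strict Implicit.
Unset Printing Implicit Defensive.

Import Order.TTheory GRing.Theory Num.Theory.
Import numFieldNormedType.Exports.

Local Open Scope classical_set_scope.
Local Open Scope ring_scope.

(** Write f(P) for the generalized Euler constant of P and d(P) for its density.
Adjoining a prime p to P removes from the P-sifted integers the multiples of p,
and n = p m is P-sifted exactly when m is. Hence the sum of 1/n over the sifted
n <= x satisfies S_{P + p}(x) = S_P(x) - S_P(x / p) / p, and in the limit

  f(P + p) = f(P) - (f(P) - d(P) ln p) / p                 ([gen_eulerU1]).

The same relation, without logarithms, for the counting function gives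
d(P + p) = d(P) (1 - 1/p). Starting from the existence of the classical Euler
constant ([sieve_limits0]), induction on P shows that all the limits exist
([sieve_limits_exist]) and that d(P) >= 0.

Now let q < p be two primes outside P. If f(P) <= d(P) ln p, the recurrence
gives f(P + p) >= f(P). Otherwise the quantity (f(P) - d(P) ln t) / t is
nonnegative and nonincreasing for t in [q, p], so f(P + p) >= f(P + q). In a
set of primes one may therefore either delete p or replace it by the smaller q
without increasing f ([gen_euler_exchange]); neither move increases the
cardinality.

Finally let r be maximal such that P contains the first r primes; then r <= #P
and the next prime q is not in P. Either P consists of the first r primes, or it
has an element p > q, to which the exchange applies. Both moves decrease the sum
of the elements of P, so the process stops, at a set of first primes. *)

(** * Floors and limits at infinity *)

Section RealParameter.
Context {R : realType}.
Implicit Types (x : R) (P : {fset nat}).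

Lemma truncn_divn x (p : nat) : (0 < p)%N -> 0 <= x ->
  Num.truncn (x / p%:R) = (Num.truncn x %/ p)%N.
Proof.
move=> p0 x0; apply: truncn_def.
have p0R : 0 < p%:R :> R by rewrite ltr0n.
have /andP[Nx xN] := truncn_itv x0.
rewrite ler_pdivlMr// ltr_pdivrMr// -!natrM; apply/andP; split.
  by apply: le_trans Nx; rewrite ler_nat leq_divM.
by apply: lt_le_trans xN _; rewrite ler_nat ltn_ceil.
Qed.

Lemma cvg_truncn : @Num.truncn R x @[x --> +oo] --> \oo.
Proof.
apply/cvgnyPge => A; near=> x.
have Ax : A%:R <= x by near: x; apply: nbhs_pinfty_ge; rewrite num_real.
by rewrite truncn_ge_nat// (le_trans _ Ax).
Unshelve. all: by end_near. Qed.

Lemma cvg_divn_pinfty (f : R -> R) (l : R) (p : nat) :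
  (0 < p)%N -> f @ +oo --> l -> f (x / p%:R) @[x --> +oo] --> l.
Proof.
move=> p0 fl; apply: (cvg_comp (fun x => x / p%:R) f _ fl).
by apply: gt0_cvgMly; [rewrite invr_gt0 ltr0n|exact: cvg_id].
Qed.

Lemma cvg_truncn_div : (Num.truncn x)%:R / x @[x --> +oo] --> (1 : R).
Proof.
apply: (@squeeze_cvgr _ _ _ _ (fun x => 1 - x^-1) (fun=> 1)); last first.
- exact: cvg_cst.
- rewrite -[X in _ --> X]subr0; apply: cvgB; first exact: cvg_cst.
  apply/gtr0_cvgV0; first by apply: nbhs_pinfty_gt; rewrite num_real.
  exact: cvg_id.
near=> x.
have x0 : 0 < x by near: x; apply: nbhs_pinfty_gt; rewrite num_real.
have /andP[Nx xN] := truncn_itv (ltW x0).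
rewrite ler_pdivrMr// mul1r Nx andbT ler_pdivlMr// mulrBl mul1r mulVf ?gt_eqF//.
by rewrite lerBlDr natr1 ltW.
Unshelve. all: by end_near. Qed.

(** * The classical Euler constant *)

Definition harmonic_defect (n : nat) : R := \sum_(1 <= k < n.+1) k%:R^-1 - ln n%:R.

(** Both bounds are ln (1 + t) <= t, taken at t = -1/(n+1) and at t = 1/n. *)
Lemma ln_natS_sub (n : nat) : (0 < n)%N ->
  n.+1%:R^-1 <= ln n.+1%:R - ln n%:R :> R /\ ln n.+1%:R - ln n%:R <= n%:R^-1 :> R.
Proof.
move=> n0.
have nR : 0 < n%:R :> R by rewrite ltr0n.
have SR : 0 < n.+1%:R :> R by rewrite ltr0n.
rewrite -natr1 in SR *; split.
  rewrite -[leLHS]opprK lerNl opprB -ln_div//.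
  have -> : n%:R / (n%:R + 1) = 1 + - (n%:R + 1)^-1 :> R by field; rewrite gt_eqF.
  by apply: le_ln1Dx; rewrite ltrN2 invf_lt1// ltrDr.
rewrite -ln_div//.
have -> : (n%:R + 1) / n%:R = 1 + n%:R^-1 :> R by field; rewrite gt_eqF.
by apply: le_ln1Dx; apply: lt_trans (_ : 0 < _); rewrite ?ltrN10 ?invr_gt0.
Qed.

(** From index 1 on, the sequence is nonincreasing by the lower bound of
[ln_natS_sub] and nonnegative by its upper bound. *)
Lemma is_cvg_harmonic_defect : cvgn harmonic_defect.
Proof.
(* The shift avoids index 0, where the defect is 0 because ln 0 = 0. *)
suff /cvg_ex[l hl] : cvgn [sequence harmonic_defect n.+1]_n.
  by apply/cvg_ex; exists l; rewrite -cvg_shiftS.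
apply: nonincreasing_is_cvgn.
  apply/nonincreasing_seqP => n; rewrite /= /harmonic_defect big_nat_recr//=.
  rewrite -addrA lerD2l lerBlDl.
  by have [] := @ln_natS_sub n.+1 isT.
exists 0 => _ [n _ <-] /=; rewrite /harmonic_defect subr_ge0.
(* Telescoping ln (k+1) - ln k <= 1/k up to k = n+1 bounds ln (n+2). *)
apply: (@le_trans _ _ (ln n.+2%:R)).
  by rewrite ler_ln ?posrE ?ltr0n// ler_nat.
elim: n => [|n IHn]; rewrite big_nat_recr//=.
  have [_] := @ln_natS_sub 1 isT.
  by rewrite big_geq// ln1 add0r subr0.
have [_ h] := @ln_natS_sub n.+2 isT.
by rewrite -[leLHS](subrK (ln n.+2%:R)) addrC lerD.
Qed.


(** * Adjoining a prime to the sieve *)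

Definition sifted_mean P x : R :=
  x^-1 * \sum_(1 <= n < (Num.truncn x).+1) sifted R P n.

Definition sifted_harmonic P x : R :=
  \sum_(1 <= n < (Num.truncn x).+1) sifted R P n / n%:R.

(** The two limits are asserted together because the logarithmic term of the
second is weighted by the value of the first. *)
Definition sieve_limits P (d g : R) : Prop :=
  sifted_mean P @ +oo --> d /\
  (fun x => sifted_harmonic P x - d * ln x) @ +oo --> g.

Lemma sieve_limitsE P d g : sieve_limits P d g ->
  density R P = d /\ gen_euler R P = g.
Proof.
move=> [Pd Pg]; have dE : density R P = d by apply: cvg_lim.
by split=> //; rewrite /gen_euler dE; apply: cvg_lim.
Qed.

Lemma sifted0 n : sifted R fset0 n = 1.
Proof. by rewrite /sifted big_seq_fset0 gcdn1. Qed.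

(** With N = floor x, the sum of 1/n over n <= x minus ln x splits into the
harmonic defect at N plus ln (N / x), and N / x tends to 1. *)
Lemma sieve_limits0 : exists g : R, sieve_limits fset0 1 g.
Proof.
have /cvg_ex[/= l hl] := is_cvg_harmonic_defect.
exists l; split.
  apply: cvg_trans cvg_truncn_div; apply: near_eq_cvg; near=> x.
  rewrite /sifted_mean (eq_bigr _ (fun n _ => sifted0 n)).
  by rewrite sumr_const_nat subn1 mulrC.
rewrite -[l]addr0.
suff lim_sum : (harmonic_defect (Num.truncn x) + ln ((Num.truncn x)%:R / x))
    @[x --> +oo] --> l + 0.
  apply: cvg_trans lim_sum; apply: near_eq_cvg; near=> x.
  have x1 : 1 <= x by near: x; apply: nbhs_pinfty_ge; rewrite num_real.
  have x0 := lt_le_trans ltr01 x1.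
  have N0 : 0 < (Num.truncn x)%:R :> R by rewrite ltr0n truncn_ge_nat ?ltW.
  rewrite /harmonic_defect /sifted_harmonic ln_div// addrA subrK mul1r.
  by congr (_ - _); apply: eq_bigr => n _; rewrite sifted0 mul1r.
apply: cvgD; first exact: (cvg_comp _ _ cvg_truncn hl).
rewrite -[X in _ --> X](@ln1 R).
apply: (cvg_comp _ _ cvg_truncn_div).
exact: (continuous_ln ltr01).
Unshelve. all: by end_near. Qed.

Lemma siftedU1 P p n : prime p -> p \notin P ->
  sifted R (p |` P)%fset n = if (p %| n)%N then 0 else sifted R P n.
Proof.
move=> pp pP; rewrite /sifted big_fsetU1//= -/(coprime _ _) coprimeMr.
by rewrite (coprime_sym n p) prime_coprime//; case: (p %| n)%N.
Qed.

Lemma siftedMl P p n : prime_fset P -> prime p -> p \notin P ->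
  sifted R P (p * n)%N = sifted R P n.
Proof.
move=> PP pp pP; rewrite /sifted -!/(coprime _ _) coprimeMl.
suff -> : coprime p (\prod_(q <- P) q) by [].
rewrite big_seq; apply: (big_ind (coprime p)) => [|a b ha hb|q].
- exact: coprimen1.
- by rewrite coprimeMr ha.
- move=> qP; rewrite prime_coprime// dvdn_prime2 ?(PP q)//.
  by apply: contraNneq pP => ->.
Qed.

(** The sieve identity, with a weight F so that it serves both the counting
function (F = 1) and the harmonic sum (F n = 1/n). *)
Lemma sum_siftedU1 P p (F : nat -> R) (N : nat) :
  prime_fset P -> prime p -> p \notin P ->
  \sum_(1 <= n < N.+1) sifted R (p |` P)%fset n * F n =
  \sum_(1 <= n < N.+1) sifted R P n * F n
  - \sum_(1 <= m < (N %/ p).+1) sifted R P m * F (p * m)%N.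
Proof.
move=> PP pp pP; elim: N => [|N IHN].
  by rewrite div0n !big_geq// subr0.
rewrite !(big_nat_recr N.+1)//= IHN siftedU1// divnS ?prime_gt0//.
(* The last sum gains a term exactly when p divides N + 1. *)
case: ifP => pN; last by rewrite add0n addrAC.
rewrite mul0r addr0 add1n (big_nat_recr (N %/ p).+1)//=.
have pNE : (p * (N %/ p).+1)%N = N.+1.
  by rewrite -(divnK pN) mulnC divnS ?prime_gt0// pN.
rewrite pNE.
have -> : sifted R P N.+1 = sifted R P (N %/ p).+1.
  by rewrite -pNE siftedMl.
by rewrite opprD addrACA subrr addr0.
Qed.

(** Divide the sieve identity by x, or subtract the logarithmic term, and use
that a limit at infinity is unchanged by x |-> x / p. The ln p in the second
value comes from ln (x / p) = ln x - ln p. *)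
Lemma sieve_limitsU1 P p d g : prime_fset P -> prime p -> p \notin P ->
  sieve_limits P d g ->
  sieve_limits (p |` P)%fset (d - d / p%:R) (g - (g - d * ln p%:R) / p%:R).
Proof.
move=> PP pp pP [Pd Pg].
have p0 := prime_gt0 pp.
have pR : 0 < p%:R :> R by rewrite ltr0n.
split.
  have : (sifted_mean P x - sifted_mean P (x / p%:R) / p%:R)
      @[x --> +oo] --> d - d / p%:R.
    by apply: cvgB => //; apply: cvgMl; apply: cvg_divn_pinfty.
  apply: cvg_trans; apply: near_eq_cvg; near=> x.
  have x0 : 0 < x by near: x; apply: nbhs_pinfty_gt; rewrite num_real.
  rewrite /sifted_mean truncn_divn ?ltW//.
  have := sum_siftedU1 (fun=> 1) (Num.truncn x) PP pp pP.
  under eq_bigr do rewrite mulr1.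
  under [in RHS]eq_bigr do rewrite mulr1.
  under [X in _ = _ - X]eq_bigr do rewrite mulr1.
  move=> ->; field; by rewrite !gt_eqF.
have : (sifted_harmonic P x - d * ln x
        - (sifted_harmonic P (x / p%:R) - d * ln (x / p%:R) + - (d * ln p%:R))
            / p%:R)
      @[x --> +oo] --> g - (g - d * ln p%:R) / p%:R.
  apply: cvgB => //; apply: cvgMl; apply: cvgD; last exact: cvg_cst.
  exact: (@cvg_divn_pinfty (fun x => sifted_harmonic P x - d * ln x)).
apply: cvg_trans; apply: near_eq_cvg; near=> x.
have x0 : 0 < x by near: x; apply: nbhs_pinfty_gt; rewrite num_real.
rewrite /sifted_harmonic truncn_divn ?ltW// sum_siftedU1// ln_div//.
under [X in _ = _ - X - _]eq_bigr do rewrite natrM invfM mulrCA.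
rewrite -mulr_sumr; field; by rewrite gt_eqF.
Unshelve. all: by end_near. Qed.

(** The sign of the density is carried along the induction, since it is read
off from the factors 1 - 1/p. *)
Lemma sieve_limits_exist P : prime_fset P ->
  exists d g, 0 <= d /\ sieve_limits P d g.
Proof.
elim/finSet_rect: P => P IHP PP.
have [->|[p pP]] := fset_0Vmem P.
  by have [g ?] := sieve_limits0; exists 1, g.
have [||d [g [d0 lim_dg]]] := IHP (P `\ p)%fset.
- exact: fproperD1.
- by move=> q /fsetD1P[_ /PP].
exists (d - d / p%:R), (g - (g - d * ln p%:R) / p%:R); split.
  rewrite subr_ge0 ler_pdivrMr ?ltr0n ?prime_gt0 ?(PP p)//.
  by rewrite ler_peMr// ler1n prime_gt0// (PP p).
rewrite -(fsetD1K pP); apply: sieve_limitsU1 => //.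
- by move=> q /fsetD1P[_ /PP].
- exact: PP.
- by rewrite !inE eqxx.
Qed.

Lemma density_ge0 P : prime_fset P -> 0 <= density R P.
Proof.
by move=> /sieve_limits_exist[d [g [d0 /sieve_limitsE[-> _]]]].
Qed.

Lemma gen_eulerU1 P p : prime_fset P -> prime p -> p \notin P ->
  gen_euler R (p |` P)%fset =
  gen_euler R P - (gen_euler R P - density R P * ln p%:R) / p%:R.
Proof.
move=> PP pp pP; have [d [g [_ lim_dg]]] := sieve_limits_exist PP.
have [-> ->] := sieve_limitsE lim_dg.
by have [_] := sieve_limitsE (sieve_limitsU1 PP pp pP lim_dg).
Qed.

(** * The exchange inequality *)

(** By the recurrence, f(P + t) = f(P) - (f(P) - d(P) ln t) / t. If the
numerator is nonpositive at t = p, the first alternative holds; if it is positive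
there, neither it nor 1/t is smaller at t = q, so the second one holds. *)
Lemma gen_euler_exchange P q p : prime_fset P ->
  prime q -> prime p -> q \notin P -> p \notin P -> (q < p)%N ->
  gen_euler R P <= gen_euler R (p |` P)%fset \/
  gen_euler R (q |` P)%fset <= gen_euler R (p |` P)%fset.
Proof.
move=> PP pq pp qP pP qp; rewrite !gen_eulerU1//.
have d0 := density_ge0 PP.
have q0 : 0 < q%:R :> R by rewrite ltr0n prime_gt0.
have p0 : 0 < p%:R :> R by rewrite ltr0n prime_gt0.
set g := gen_euler R P; set d := density R P.
have [gp|gp] := leP g (d * ln p%:R); [left|right].
  by rewrite lerDl oppr_ge0 mulr_le0_ge0 ?invr_ge0 ?subr_le0// ltW.
rewrite lerD2l lerN2; apply: ler_pM.
- by rewrite subr_ge0 ltW.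
- by rewrite invr_ge0 ltW.
- rewrite lerD2l lerN2 ler_wpM2l// ler_ln ?posrE// ler_nat; exact: ltnW.
- by rewrite lef_pV2 ?posrE// ler_nat ltnW.
Qed.

End RealParameter.

(** * Sets of first primes *)

Lemma prime_nth_prime r : prime (nth_prime r).
Proof.
case: r => // r; rewrite /nth_prime /= /next_prime.
by case: ex_minnP => m /andP[].
Qed.

Lemma mem_first_primes r p :
  (p \in first_primes r) = prime p && (p < nth_prime r)%N.
Proof.
rewrite in_fset /=; elim: r => [|r IHr].
  by apply/esym/andP => -[/prime_gt1]; rewrite /nth_prime /=; case: p => [|[|]].
rewrite mkseqS mem_rcons in_cons IHr /nth_prime /= -/(nth_prime r) /next_prime.
have pr_r := prime_nth_prime r.
case: ex_minnP => m /andP[rm pm] m_min.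
apply/orP/andP => [[/eqP->|/andP[pp pr]]|[pp pm_lt]].
- by [].
- by split=> //; exact: ltn_trans rm.
- have [pr|rp|->] := ltngtP p (nth_prime r).
  + by right; rewrite pp.
  + by have := m_min p; rewrite rp pp leqNgt pm_lt => /(_ isT).
  + by left.
Qed.

Lemma first_primesS r :
  first_primes r.+1 = (nth_prime r |` first_primes r)%fset.
Proof.
by apply/fsetP => p; rewrite in_fset1U !in_fset /= mkseqS mem_rcons in_cons.
Qed.

Lemma first_primes_prime r : prime_fset (first_primes r).
Proof. by move=> p; rewrite mem_first_primes => /andP[]. Qed.

Lemma card_first_primes r : #|` first_primes r| = r.
Proof.
elim: r => [|r IHr]; first by apply/eqP; rewrite cardfs_eq0; apply/eqP/fsetP => p; rewrite in_fset.
by rewrite first_primesS cardfsU1 mem_first_primes ltnn andbF IHr.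
Qed.

(** Take r maximal such that P contains the first r primes; the cardinality of P
bounds such r. *)
Lemma exists_first_missing_prime (P : {fset nat}) : exists r : nat,
  [/\ (r <= #|` P|)%N, (first_primes r `<=` P)%fset & nth_prime r \notin P].
Proof.
have ex0 : exists r, (first_primes r `<=` P)%fset.
  by exists 0%N; apply/fsubsetP => p; rewrite in_fset.
have bound r : (first_primes r `<=` P)%fset -> (r <= #|` P|)%N.
  by move=> /fsubset_leq_card; rewrite card_first_primes.
have [r rP r_max] := ex_maxnP ex0 bound.
exists r; split=> //; first exact: bound.
apply/negP => nth_r; have := r_max r.+1.
by rewrite first_primesS fsubUset fsub1set nth_r rP ltnn => /(_ isT).
Qed.

(** * Comparison with the first primes *)

(** Induction on the sum of the elements of P, which drops both when p is
deleted and when it is replaced by the smaller missing prime. *)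
Lemma gen_euler_ge_euler_r (R : realType) (P : {fset nat}) : prime_fset P ->
  exists r : nat, (r <= #|` P|)%N /\ euler_r R r <= gen_euler R P.
Proof.
have [n] := ubnP (\sum_(p <- P) p)%N.
elim: n => // n IHn in P * => Pn PP.
have [r [rP sub_rP nth_rP]] := exists_first_missing_prime P.
have [P_r|/fsubsetPn[p pP]] := boolP (P `<=` first_primes r)%fset.
  exists r; split=> //.
  suff /eqP -> : P == first_primes r by [].
  by rewrite eqEfsubset P_r.
have pp := PP p pP; have pr_q := prime_nth_prime r.
rewrite mem_first_primes pp -leqNgt /= => qp.
have {}qp : (nth_prime r < p)%N.
  by rewrite ltn_neqAle qp andbT; apply: contraNneq nth_rP => ->.
set Q := (P `\ p)%fset.
have QP : prime_fset Q by move=> x /fsetD1P[_ /PP].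
have pQ : p \notin Q by rewrite !inE eqxx.
have qQ : nth_prime r \notin Q by rewrite !inE (negbTE nth_rP) andbF.
move: Pn rP; rewrite -(fsetD1K pP) -/Q big_fsetU1//= cardfsU1 pQ add1n ltnS => Pn rP.
have [le_Q|le_qQ] := gen_euler_exchange (R := R) QP pr_q pp qQ pQ qp.
  have [||k [kQ le_k]] := IHn Q => //.
    by apply: leq_trans Pn; rewrite -[ltnLHS]add0n ltn_add2r prime_gt0.
  by exists k; split; [exact: leqW|exact: le_trans le_k le_Q].
have [||k [kQ le_k]] := IHn (nth_prime r |` Q)%fset.
- by rewrite big_fsetU1//=; apply: leq_trans Pn; rewrite ltn_add2r.
- by move=> x /fset1UP[->|/QP].
- exists k; split; last exact: le_trans le_k le_qQ.
  by rewrite cardfsU1 qQ add1n in kQ.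
Qed.

Theorem theorem1 (R : realType) :
  (forall P : {fset nat}, prime_fset P ->
     exists r : nat, (r <= #|` P|)%N /\ euler_r R r <= gen_euler R P) /\
  Gamma R = ereal_inf (range (fun r : nat => (euler_r R r)%:E)).
Proof.
split; first exact: gen_euler_ge_euler_r.
apply/eqP; rewrite eq_le; apply/andP; split.
  apply: le_ereal_inf => _ [r _ <-].
  by exists (first_primes r) => //; exact: first_primes_prime.
apply: le_ereal_inf_tmp => _ [P PP <-].
have [r [_ le_r]] := gen_euler_ge_euler_r R PP.
apply: (@le_trans _ _ (euler_r R r)%:E); last by rewrite lee_fin.
by apply: ereal_inf_lbound; exists r.
Qed.
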